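(* Let $G$ be a finitely generated abelian group, $\psi:G\to G$ an injective, non-surjective homomorphism, $G*_{\psi}$ the associated ascending HNN-extension, and $\mathcal{A}$ a finite alphabet. Let $x\in \mathcal{A}^{G*_{\psi}}$ and suppose there exist a subgroup $H\leqslant G$ with $\psi(H)\leqslant H$ and an integer $\ell\ge 0$ such that $\psi^{\ell}(H)\leqslant \mathrm{Stab}(x)$. Then: (1) all $G$-sections of $x$ of level greater than or equal to $\ell$ are $H$-periodic; (2) if $X\subseteq\mathcal{A}^{G*_{\psi}}$ is a $G*_{\psi}$-subshift which contains $x$, then there exists $y\in X$ for which all $G$-sections are $H$-periodic; and (3) if $X$ is a $G*_{\psi}$-subshift of finite type which contains $x$ and $H=G$, then the configuration $y$ in (2) can be chosen to be strongly periodic.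
   Context: If $G=\langle S\mid R\rangle$ and $\psi:G\to G$ is a monomorphism, the ascending HNN-extension is $G*_{\psi}=\langle S\cup\{t\}\mid R\cup\{tgt^{-1}=\psi(g): g\in G\}\rangle$; $t$ is the stable letter, $G$ is regarded as a subgroup of $G*_\psi$, and $\psi^{\ell}$ is the $\ell$-fold composition of $\psi$ with itself. For a group $\Lambda$ and a finite discrete set $\mathcal{A}$, $\mathcal{A}^\Lambda$ has the product topology and the shift action $\sigma_g(x)_h=x_{g^{-1}h}$. Its elements are called configurations. $\mathrm{Stab}(x)=\{g\in\Lambda:\sigma_g(x)=x\}$, $\mathrm{Orb}(x)=\{\sigma_g(x):g\in\Lambda\}$; $x$ is strongly periodic if $\mathrm{Orb}(x)$ is finite. A $\Lambda$-subshift is a closed $\sigma$-invariant subset of $\mathcal{A}^\Lambda$. It is a subshift of finite type (SFT) if there is a finite family $\mathcal{F}$ of patterns (elements of $\mathcal{A}^F$, $F\subseteq\Lambda$ finite) such that $X$ is the set of all $x$ such that for every finite $F\subseteq \Lambda$ and $g\in\Lambda$, $\sigma_g(x)|_F\notin\mathcal{F}$. For $h\in G*_{\psi}$, the $G$-section containing $h$ is $\Gamma_h=\{hg: g\in G\}$. Every $h\in G*_\psi$ is written uniquely as $h=t^{-j}gt^{i}$ with $i,j\ge0$, $g\in G$, where $g\in\psi(G)$ is allowed only if $i=0$ or $j=0$; the level of $\Gamma_h$ is $i-j$ (this is well defined). For $H\leqslant G$ and $x\in\mathcal{A}^{G*_\psi}$, the $G$-section $\Gamma_h$ of $x$ is $H$-periodic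 if $x_{hgg'}=x_{hg}$ for all $g\in G$, $g'\in H$. *)

(* Defs.v *)
From HB Require Import structures.
From mathcomp Require Import all_boot all_order all_algebra finmap.
From mathcomp Require Import all_classical.
From mathcomp Require Import topology function_spaces.
Set Implicit Arguments.
Unset Strict Implicit.
Unset Printing Implicit Defensive.

Local Open Scope classical_set_scope.
Local Open Scope quotient_scope.
Local Open Scope group_scope.

Definition subgroup (G : groupType) (H : set G) : Prop :=
  H 1 /\ forall g h, H g -> H h -> H (g / h).

Definition finitely_generated (G : groupType) : Prop :=
  exists s : seq G,
    forall K : set G, subgroup K -> (forall g, g \in s -> K g) -> K = setT.

(* The letter [(s, true)] stands for the generator [s], and [(s, false)] for
   its inverse.  *)
Definition word (S : Type) : Type := seq (S * bool).

Inductive word_equiv (S : Type) (R : word S -> word S -> Prop) :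
    word S -> word S -> Prop :=
| word_equiv_refl u : word_equiv R u u
| word_equiv_sym u v : word_equiv R u v -> word_equiv R v u
| word_equiv_trans u v w :
    word_equiv R u v -> word_equiv R v w -> word_equiv R u w
| word_equiv_cat u u' v v' :
    word_equiv R u u' -> word_equiv R v v' -> word_equiv R (u ++ v) (u' ++ v')
| word_equiv_cancel s b : word_equiv R [:: (s, b); (s, ~~ b)] [::]
| word_equiv_rel u v : R u v -> word_equiv R u v.

Section PresentedGroup.
Variables (S : choiceType) (R : word S -> word S -> Prop).
Implicit Types u v w : word S.

Let equivb : rel (seq (S * bool)) := fun u v => `[< word_equiv R u v >].

Lemma equivb_refl : reflexive equivb.
Proof. by move=> u; apply/asboolP; exact: word_equiv_refl. Qed.

Lemma equivb_sym : symmetric equivb.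
Proof.
by move=> u v; apply/asboolP/asboolP => /word_equiv_sym.
Qed.

Lemma equivb_trans : transitive equivb.
Proof.
by move=> v u w /asboolP uv /asboolP vw; apply/asboolP; exact: word_equiv_trans vw.
Qed.

Definition word_equiv_rel_canonical :=
  EquivRel equivb equivb_refl equivb_sym equivb_trans.

(* The group <S | u = v for all (u, v) in R>.  *)
Definition presented : Type := {eq_quot word_equiv_rel_canonical}.

HB.instance Definition _ := Choice.copy presented {eq_quot word_equiv_rel_canonical}.

Definition word_class u : presented := \pi_{eq_quot word_equiv_rel_canonical} u.

Definition class_repr (x : presented) : word S :=
  repr (x : {eq_quot word_equiv_rel_canonical}).

Definition word_inv u : word S := rev [seq (l.1, ~~ l.2) | l <- u].

Definition presented_one : presented := word_class [::].
Definition presented_mul (x y : presented) : presented :=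
  word_class (class_repr x ++ class_repr y).
Definition presented_inv (x : presented) : presented :=
  word_class (word_inv (class_repr x)).

Lemma word_classP u v : word_class u = word_class v <-> word_equiv R u v.
Proof.
split; first by move=> /eqmodP /asboolP.
by move=> uv; apply/eqmodP/asboolP.
Qed.

Lemma class_reprK x : word_class (class_repr x) = x.
Proof. exact: reprK. Qed.

Lemma class_repr_equiv u : word_equiv R (class_repr (word_class u)) u.
Proof. by apply/word_classP; rewrite class_reprK. Qed.

Lemma word_class_cat u v :
  word_class (u ++ v) = presented_mul (word_class u) (word_class v).
Proof.
by apply/esym/word_classP; apply: word_equiv_cat; exact: class_repr_equiv.
Qed.

Lemma word_invl u : word_equiv R (word_inv u ++ u) [::].
Proof.
elim: u => [|[s b] u IHu]; first exact: word_equiv_refl.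
rewrite /word_inv /= rev_cons cat_rcons.
apply: word_equiv_trans IHu; apply: word_equiv_cat; first exact: word_equiv_refl.
rewrite -[X in word_equiv _ _ X]cat0s -[(s, b) :: u]cat1s -cat1s catA.
apply: word_equiv_cat; last exact: word_equiv_refl.
by have := word_equiv_cancel R s (~~ b); rewrite negbK.
Qed.

Lemma word_invK : involutive word_inv.
Proof.
move=> u; rewrite /word_inv map_rev revK -map_comp -[RHS]map_id.
by apply: eq_map => -[s b] /=; rewrite negbK.
Qed.

Lemma word_invr u : word_equiv R (u ++ word_inv u) [::].
Proof. by have := word_invl (word_inv u); rewrite word_invK. Qed.

Lemma presented_mulA : associative presented_mul.
Proof.
move=> x y z; rewrite -[x]class_reprK -[y]class_reprK -[z]class_reprK.
by rewrite -!word_class_cat catA.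
Qed.

Lemma presented_mul1g : left_id presented_one presented_mul.
Proof. by move=> x; rewrite -[x]class_reprK -word_class_cat. Qed.

Lemma presented_mulg1 : right_id presented_one presented_mul.
Proof. by move=> x; rewrite -[x]class_reprK -word_class_cat cats0. Qed.

Lemma presented_mulVg : left_inverse presented_one presented_inv presented_mul.
Proof.
move=> x; rewrite -[X in presented_mul _ X]class_reprK -word_class_cat.
exact/word_classP/word_invl.
Qed.

Lemma presented_mulgV : right_inverse presented_one presented_inv presented_mul.
Proof.
move=> x; rewrite -[X in presented_mul X _]class_reprK -word_class_cat.
exact/word_classP/word_invr.
Qed.

HB.instance Definition _ := isGroup.Build presented
  presented_mulA presented_mul1g presented_mulg1 presented_mulVg presented_mulgV.

End PresentedGroup.

(* G is presented by all its elements and its multiplication table; [None] is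
   the stable letter.  *)
Inductive hnn_relation (G : groupType) (psi : G -> G) :
    word (option G) -> word (option G) -> Prop :=
| hnn_relation_mul g h :
    hnn_relation psi [:: (Some g, true); (Some h, true)] [:: (Some (g * h), true)]
| hnn_relation_conj g :
    hnn_relation psi [:: (None, true); (Some g, true); (None, false)]
      [:: (Some (psi g), true)].

Section AscendingHNN.
Variables (G : groupType) (psi : G -> G).

Definition hnn : Type := presented (hnn_relation psi).

HB.instance Definition _ := Group.copy hnn (presented (hnn_relation psi)).

Definition hnn_incl (g : G) : hnn :=
  word_class (hnn_relation psi) [:: (Some g, true)].

Definition hnn_t : hnn := word_class (hnn_relation psi) [:: (None, true)].

Lemma hnn_inclM : {morph hnn_incl : g h / g * h}.
Proof.
move=> g h; apply/esym; rewrite /hnn_incl.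
rewrite -[LHS](word_class_cat (hnn_relation psi) [:: _] [:: _]).
exact/word_classP/word_equiv_rel/hnn_relation_mul.
Qed.

HB.instance Definition _ := isMultiplicative.Build G hnn hnn_incl hnn_inclM.

Lemma hnn_conjE g : hnn_t * hnn_incl g * hnn_t^-1 = hnn_incl (psi g).
Proof.
apply: (canLR (mulgK _)).
rewrite -[LHS](word_class_cat (hnn_relation psi) [:: _] [:: _]).
rewrite -[RHS](word_class_cat (hnn_relation psi) [:: _] [:: _]).
apply/word_classP.
apply: (@word_equiv_trans _ _ _
  ([:: (None, true); (Some g, true); (None, false)] ++ [:: (None, true)])).
  rewrite /= -[X in word_equiv _ X _]cats0.
  apply: (@word_equiv_cat _ _ [:: _; _] [:: _; _] [::] [:: _; _]).
    exact: word_equiv_refl.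
  exact/word_equiv_sym/(word_equiv_cancel _ _ false).
apply: (@word_equiv_cat _ _ _ [:: _] [:: _] [:: _]).
  exact/word_equiv_rel/hnn_relation_conj.
exact: word_equiv_refl.
Qed.

(* The level of the section h G, read off a normal form t^-j g t^i of h; it
   is a relation, so that the uniqueness of normal forms is not presupposed.  *)
Definition section_level (h : hnn) (n : int) : Prop :=
  exists (j i : nat) (g : G),
    [/\ h = hnn_t ^- j * hnn_incl g * hnn_t ^+ i,
        range psi g -> i = 0%N \/ j = 0%N
      & n = (i%:Z - j%:Z)%R].

End AscendingHNN.

Section Configurations.
Variables (L : groupType) (A : finType).

Definition configuration : Type := {ptws L -> discrete_topology A}.

HB.instance Definition _ :=
  Topological.copy configuration {ptws L -> discrete_topology A}.

Definition shift (g : L) (x : configuration) : configuration :=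
  fun h => x (g^-1 * h).

Definition stab (x : configuration) : set L := [set g | shift g x = x].

Definition orb (x : configuration) : set configuration :=
  range (fun g => shift g x).

Definition strongly_periodic (x : configuration) : Prop := finite_set (orb x).

Definition subshift (X : set configuration) : Prop :=
  closed X /\ forall g x, X x -> X (shift g x).

(* A pattern is a finite map: its support is its domain.  *)
Definition restriction (x : configuration) (F : {fset L}) : {fmap L -> A} :=
  [fmap u : F => (x (val u) : A)]%fmap.

Definition sft (X : set configuration) : Prop :=
  subshift X /\
  exists Fs : seq {fmap L -> A},
    X = [set x | forall (F : {fset L}) (g : L),
                   restriction (shift g x) F \notin Fs].

End Configurations.

Definition section_periodic (G : groupType) (psi : G -> G) (A : finType)
    (H : set G) (x : configuration (hnn psi) A) (h : hnn psi) : Prop :=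
  forall g g', H g' ->
    x (h * hnn_incl psi g * hnn_incl psi g') = x (h * hnn_incl psi g).

(* Main.v *)
Require Import Defs.
From mathcomp Require Import all_boot all_order all_algebra finmap.
From mathcomp Require Import all_classical.
From mathcomp Require Import topology function_spaces.
From mathcomp Require Import zify.

(** Why the theorem holds.  Write t for the stable letter.  Moving a stable
letter to the right past an element of G applies psi, so every element of the
extension has the form t^-j a t^i with a in G ([hnn_normal_form]).  Since G is
abelian, right multiplication by g' at a point of the section of t^-j a t^i is
left multiplication by t^-j psi^i(g') t^j.  Periodicity of a section is
therefore a statement about the stabilizer ([section_periodic_stab]), and at
level i - j >= l the left multiplier is psi^(i-j)(g'), which lies in psi^l(H)
and fixes x.  This is (1).

For (2), shift x by t^-n.  The new stabilizer contains t^-j H t^j as soon as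
n >= j + l, so by compactness a cluster point y in X of these shifts is fixed
by all the conjugates t^-j H t^j at once ([limit_stab], [conj_stab_shift]), and
all its sections are H-periodic.

For (3), when H = G these conjugates exhaust the kernel of the homomorphism
[degree] onto the integers which kills G and sends t to 1.  So y is the
pullback of a bi-infinite sequence, and the finitely many forbidden patterns
only see windows of bounded length in that sequence.  As in the classical
one-dimensional case, some window of that length occurs twice; repeating the
stretch between the two occurrences gives a periodic sequence with no new
window ([sft_periodic_point]).  Its pullback depends on the degree modulo the
period, hence has finite orbit. *)

Set Implicit Arguments.
Unset Strict Implicit.
Unset Printing Implicit Defensive.

Local Open Scope classical_set_scope.
Local Open Scope group_scope.

(** * Normal forms in the ascending HNN-extension *)

Lemma hnn_letter_inv (G : groupType) (psi : G -> G) s :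
  word_class (hnn_relation psi) [:: (s, false)] =
  (word_class (hnn_relation psi) [:: (s, true)] : hnn psi)^-1.
Proof.
apply/esym/mulg1_eq.
rewrite -[LHS](word_class_cat (hnn_relation psi) [:: _] [:: _]).
exact/word_classP/(word_equiv_cancel _ _ true).
Qed.

Lemma hnn_incl1 (G : groupType) (psi : G -> G) : hnn_incl psi 1 = 1.
Proof. by apply: (mulgI (hnn_incl psi 1)); rewrite -hnn_inclM !mulg1. Qed.

Lemma hnn_inclV (G : groupType) (psi : G -> G) g :
  hnn_incl psi g^-1 = (hnn_incl psi g)^-1.
Proof. by apply/esym/mulg1_eq; rewrite -hnn_inclM mulgV hnn_incl1. Qed.

(** Every element is a product of letters, so properties can be proved by
adding one letter on the right at a time. *)
Lemma hnn_ind (G : groupType) (psi : G -> G) (P : hnn psi -> Prop) :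
  P 1 ->
  (forall h g, P h -> P (h * hnn_incl psi g)) ->
  (forall h, P h -> P (h * hnn_t psi)) ->
  (forall h, P h -> P (h * (hnn_t psi)^-1)) ->
  forall h, P h.
Proof.
move=> P1 PG Pt PtV h; rewrite -[h]class_reprK.
elim/last_ind: (class_repr h) => [//|u l Pu].
rewrite -cats1 word_class_cat.
case: l => -[g|] [].
- exact: PG.
- rewrite hnn_letter_inv -hnn_inclV; exact: PG.
- exact: Pt.
- rewrite hnn_letter_inv; exact: PtV.
Qed.

Lemma hnn_tX_incl (G : groupType) (psi : G -> G) i g :
  hnn_t psi ^+ i * hnn_incl psi g =
  hnn_incl psi (iter i psi g) * hnn_t psi ^+ i.
Proof.
elim: i => [|i IHi] /=; first by rewrite mul1g mulg1.
by rewrite expgS -mulgA IHi mulgA -hnn_conjE !mulgA mulgVK.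
Qed.

(** The forms t^-j a t^i are closed under right multiplication by letters: an
element of G is absorbed into a after crossing t^i, and for i = 0 the letter
t^-1 crosses a at the cost of one psi. *)
Lemma hnn_normal_form (G : groupType) (psi : G -> G) (h : hnn psi) :
  exists j g i, h = hnn_t psi ^- j * hnn_incl psi g * hnn_t psi ^+ i.
Proof.
elim/hnn_ind: h => [|h g' [j [g [i ->]]]|h [j [g [i ->]]]|h [j [g [i ->]]]].
- by exists 0%N, 1, 0%N; rewrite hnn_incl1 invg1 !mulg1.
- exists j, (g * iter i psi g'), i.
  by rewrite -mulgA hnn_tX_incl hnn_inclM !mulgA.
- by exists j, g, i.+1; rewrite expgSr mulgA.
- case: i => [|i]; last by exists j, g, i; rewrite expgSr mulgA mulgK.
  exists j.+1, (psi g), 0%N.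
  by rewrite -hnn_conjE expgS invgM !mulg1 !mulgA mulgVK.
Qed.

(** * Stabilizers and limits of shifts *)

Lemma shiftM (L : groupType) (A : finType) (g h : L) (x : configuration L A) :
  shift (g * h) x = shift g (shift h x).
Proof. by rewrite /shift; apply/funext => u; rewrite invgM mulgA. Qed.

Lemma stabP (L : groupType) (A : finType) (g : L) (x : configuration L A) :
  stab x g -> forall u, x (g * u) = x u.
Proof.
move=> xg u; rewrite -{1}[x](_ : shift g x = x)//.
by rewrite /shift mulKg.
Qed.

Lemma stab_shift (L : groupType) (A : finType) (g k : L)
    (x : configuration L A) :
  stab x (k^-1 * g * k) -> stab (shift k x) g.
Proof.
by move=> xg; rewrite /stab/= -shiftM -[in RHS]xg -shiftM !mulgA mulgV mul1g.
Qed.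

Lemma closed_coincidence (L : groupType) (A : finType) (u v : L) :
  closed [set y : configuration L A | y u = y v].
Proof.
move=> y y_cl.
have coord w : nbhs y [set y' : configuration L A | y' w = y w].
  exact: (@proj_continuous L (fun=> discrete_topology A) w y _
            (discrete_set1 _)).
by have [y' [/= + [<- <-]]] := y_cl _ (filterI (coord u) (coord v)).
Qed.

Lemma configurations_compact (L : groupType) (A : finType) :
  compact [set: configuration L A].
Proof.
have := @tychonoff L (fun=> discrete_topology A) (fun=> setT).
have -> : [set f : forall i : L, discrete_topology A |
           forall i : L, setT (f i)] = setT.
  exact/seteqP.
apply=> _; apply: finite_compact; exact: (@finite_finset A).
Qed.

(** Being fixed by g is a closed condition, since it only compares coordinates
two at a time.  A cluster point of a sequence of shifts of x is therefore fixed
by every element that fixes all but finitely many of them. *)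
Lemma limit_stab (L : groupType) (A : finType) (X : set (configuration L A))
    (x : configuration L A) (s : nat -> L) :
  subshift X -> X x ->
  exists2 y, X y & forall g,
    (exists N, forall n, (N <= n)%N -> stab (shift (s n) x) g) -> stab y g.
Proof.
move=> [Xcl Xs] Xx.
have Xco : compact X.
  exact: subclosed_compact Xcl (@configurations_compact L A) _.
have FX : ((fun n => shift (s n) x) @ \oo) X by exists 0%N => // n _; exact: Xs.
have [y [Xy ycl]] := Xco _ _ FX.
exists y => // g [N sN].
rewrite /stab/=; apply/funext => u.
apply: (@closed_coincidence L A (g^-1 * u) u) => B yB.
apply: ycl yB; exists N => // n /= /sN gs.
by rewrite -[in RHS]gs.
Qed.

(** * Periodicity of sections as a property of the stabilizer *)

(** Commutativity of G turns the right translation by g at a point of the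
section into a left translation:
t^-j a t^i g' g = (t^-j psi^i(g) t^j) (t^-j a t^i g'). *)
Lemma section_periodic_stab (G : groupType) (psi : {multiplicative G -> G})
    (A : finType) (H : set G) (x : configuration (hnn psi) A) j a i :
  (forall g h : G, commute g h) ->
  (forall g, H g ->
     stab x (hnn_t psi ^- j * hnn_incl psi (iter i psi g) * hnn_t psi ^+ j)) ->
  section_periodic H x (hnn_t psi ^- j * hnn_incl psi a * hnn_t psi ^+ i).
Proof.
move=> Gab Hx g g' Hg'.
rewrite -[RHS](stabP (Hx _ Hg')); congr x.
rewrite -!mulgA mulVKg; congr (_ * _).
rewrite -hnn_inclM !hnn_tX_incl !mulgA -!hnn_inclM; congr (hnn_incl psi _ * _).
have -> : iter i psi (g * g') = iter i psi g * iter i psi g'.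
  by elim: i {Hx} => //= i ->; rewrite gmulfM.
by rewrite [LHS]mulgA -[RHS]mulgA; exact: Gab.
Qed.

Lemma iter_sub (T : Type) (f : T -> T) (H : set T) i g :
  f @` H `<=` H -> H g -> H (iter i f g).
Proof.
by move=> fH Hg; elim: i => //= i IHi; apply: fH; exists (iter i f g).
Qed.

(** Conjugating by t^n sends t^-j g t^j to psi^(n-j)(g), so high shifts of x
are fixed by elements that x itself need not be fixed by. *)
Lemma conj_stab_shift (G : groupType) (psi : G -> G)
    (A : finType) (x : configuration (hnn psi) A) j n g : (j <= n)%N ->
  stab x (hnn_incl psi (iter (n - j) psi g)) ->
  stab (shift (hnn_t psi ^- n) x)
    (hnn_t psi ^- j * hnn_incl psi g * hnn_t psi ^+ j).
Proof.
move=> jn xg; apply: stab_shift.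
have -> // : (hnn_t psi ^- n)^-1 *
    (hnn_t psi ^- j * hnn_incl psi g * hnn_t psi ^+ j) / hnn_t psi ^+ n =
    hnn_incl psi (iter (n - j) psi g).
rewrite invgK -[in X in X * _](subnK jn) -[in X in _ / X](subnK jn).
by rewrite !expgnDr !invgM !mulgA mulgK mulgK hnn_tX_incl mulgK.
Qed.

(** * The degree homomorphism *)

Definition word_exponent (T : Type) (u : word (option T)) : int :=
  (\sum_(l <- u) if l is (None, b) then if b then 1 else -1 else 0)%R.

Lemma word_exponent_equiv (G : groupType) (psi : G -> G) u v :
  word_equiv (hnn_relation psi) u v -> word_exponent u = word_exponent v.
Proof.
elim=> [//|{}u {}v _ -> //|{}u {}v w _ -> _ -> //||[s|] b|{}u {}v []].
- by move=> {}u u' {}v v' _ uu' _ vv'; rewrite /word_exponent !big_cat /=;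
    congr (_ + _)%R.
- by rewrite /word_exponent !big_cons big_nil.
- by rewrite /word_exponent !big_cons big_nil; case: b.
- by move=> g h; rewrite /word_exponent !big_cons big_nil.
- by move=> g; rewrite /word_exponent !big_cons big_nil.
Qed.

(** The homomorphism to the integers that is 0 on G and 1 on the stable
letter; on normal forms it is the level i - j of the section. *)
Definition degree (G : groupType) (psi : G -> G) (h : hnn psi) : int :=
  word_exponent (class_repr h).

Lemma degree_word (G : groupType) (psi : G -> G) u :
  degree (word_class (hnn_relation psi) u : hnn psi) = word_exponent u.
Proof. exact/word_exponent_equiv/class_repr_equiv. Qed.

Lemma degreeM (G : groupType) (psi : G -> G) (h k : hnn psi) :
  degree (h * k) = (degree h + degree k)%R.
Proof. by rewrite [LHS]degree_word /word_exponent big_cat. Qed.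

Lemma degree_incl (G : groupType) (psi : G -> G) g :
  degree (hnn_incl psi g) = 0%R.
Proof. by rewrite [LHS]degree_word /word_exponent big_seq1. Qed.

Lemma degreeV (G : groupType) (psi : G -> G) (h : hnn psi) :
  degree h^-1 = (- degree h)%R.
Proof.
have := degreeM h h^-1.
by rewrite mulgV -(hnn_incl1 psi) degree_incl; lia.
Qed.

Lemma degree_tX (G : groupType) (psi : G -> G) n :
  degree (hnn_t psi ^+ n) = n%:Z%R.
Proof.
elim: n => [|n IHn]; first by rewrite expg0 -(hnn_incl1 psi) degree_incl.
rewrite expgS degreeM IHn [degree (hnn_t psi)]degree_word.
by rewrite /word_exponent big_seq1; lia.
Qed.

(** An element of degree n has the form t^-j a t^(j+n) = (t^-j a t^j) t^n, and
the factor on the left fixes y. *)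
Lemma degree_determined (G : groupType) (psi : G -> G) (A : finType)
    (y : configuration (hnn psi) A) :
  (forall j g, stab y (hnn_t psi ^- j * hnn_incl psi g * hnn_t psi ^+ j)) ->
  forall h n, degree h = n%:Z%R -> y h = y (hnn_t psi ^+ n).
Proof.
move=> yG h n; have [j [g [i ->]]] := hnn_normal_form h.
rewrite !degreeM degreeV !degree_tX degree_incl => ijn.
have -> : i = (j + n)%N by lia.
by rewrite expgnDr mulgA (stabP (yG j g)).
Qed.

(** * Periodic points of one-dimensional subshifts of finite type *)

(** Pigeonhole: there are finitely many words of length W. *)
Lemma repeated_window (A : finType) (z : nat -> A) W :
  exists a p, (0 < p)%N /\
    forall i, (i < W)%N -> z (a + i)%N = z (a + p + i)%N.
Proof.
pose w (k : 'I_#|{ffun 'I_W -> A}|.+1) := [ffun i : 'I_W => z (k + i)%N].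
have /injectivePn[k [m km wkm]] : ~~ injectiveb w.
  apply/injectiveP => /leq_card; by rewrite card_ord ltnn.
wlog ltkm : k m km wkm / (k < m)%N.
  move=> hw; have [|] := ltnP k m; first exact: hw.
  rewrite leq_eqVlt => /orP[/eqP/val_inj mk|].
    by rewrite mk eqxx in km.
  by apply: hw => //; rewrite eq_sym.
exists k, (m - k)%N; split; first by rewrite subn_gt0.
move=> i iW; rewrite subnKC 1?ltnW//.
by have /ffunP/(_ (Ordinal iW)) := wkm; rewrite !ffunE.
Qed.

(** If the first W terms reappear after p steps, then the p-periodic extension
of the first p terms agrees with z on its first p + W terms.  Hence every
window of length at most W + 1 in the periodic sequence already occurs in z. *)
Lemma wraparound (T : Type) (z : nat -> T) W p : (0 < p)%N ->
  (forall i, (i < W)%N -> z i = z (p + i)%N) ->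
  forall m, (m < p + W)%N -> z m = z (m %% p)%N.
Proof.
move=> p_gt0 zp; elim/ltn_ind => m IHm mW.
have [mp|pm] := ltnP m p; first by rewrite modn_small.
rewrite -(subnKC pm) -zp; last by lia.
by rewrite modnDl; apply: IHm; lia.
Qed.

Lemma eq_restriction (L : groupType) (A : finType) (x y : configuration L A)
    (F : {fset L}) :
  {in F, x =1 y} -> restriction x F = restriction y F.
Proof.
move=> xy; rewrite /restriction; congr FinMap.
by apply/ffunP => u; rewrite !ffunE; exact/xy/valP.
Qed.

(** The sequence z is read along the powers of t, from an occurrence of a
repeated window on.  A forbidden pattern has support in degrees between -M and
M, so it sees at most 2M + 1 consecutive terms, and by [wraparound] whatever it
sees in the periodic configuration it also sees in some shift of y. *)
Lemma sft_periodic_point (G : groupType) (psi : G -> G) (A : finType)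
    (X : set (configuration (hnn psi) A)) (y : configuration (hnn psi) A) :
  sft X -> X y ->
  (forall h n, degree h = n%:Z%R -> y h = y (hnn_t psi ^+ n)) ->
  exists p (z : nat -> A), (0 < p)%N /\
    X (fun h => z `|(degree h %% p)%Z|%N).
Proof.
move=> [_ [Fs XE]] Xy yd.
pose M := (\max_(P <- Fs) \max_(u <- domf P) `|degree u|)%N.
have MP (P : {fmap hnn psi -> A}) u :
    P \in Fs -> u \in domf P -> (`|degree u| <= M)%N.
  move=> PFs uP; apply: leq_trans (leq_bigmax_seq _ PFs isT).
  exact: (leq_bigmax_seq u).
have [a [p [p_gt0 ap]]] :=
  repeated_window (fun n => y (hnn_t psi ^+ n)) M.*2.+1.
pose z n := y (hnn_t psi ^+ (a + n)).
exists p, z; split => //.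
have p_neq0 : (p%:Z != 0)%R by lia.
rewrite XE => F g /=; apply/negP => PFs.
(* The window seen by a pattern placed at g starts in degree at least
   - degree g - M; r is the position of that degree in the period. *)
pose r := `|((- degree g - M%:Z) %% p)%Z|%N.
have rE : ((- degree g - M%:Z) %% p)%Z = r%:Z%R.
  by rewrite /r gez0_abs // modz_ge0.
have r_lt : (r < p)%N by rewrite -ltz_nat -rE ltz_pmod.
have := Xy; rewrite XE => /(_ F (hnn_t psi ^- (a + r + M))) /negP; apply.
rewrite -(_ : restriction (shift g (fun h => z `|(degree h %% p)%Z|%N)) F =
              restriction (shift (hnn_t psi ^- (a + r + M)) y) F) //.
apply: eq_restriction => u uF.
have uM : (`|degree u| <= M)%N by exact: MP PFs uF.
have [i iE] : exists i : nat, (M%:Z + degree u = i%:Z)%R.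
  by exists `|(M%:Z + degree u)%R|%N; lia.
rewrite /shift invgK (yd _ (a + (r + i))%N); last first.
  by rewrite degreeM degree_tX; lia.
rewrite -[RHS]/(z (r + i)%N).
rewrite (@wraparound _ z M.*2.+1 p _ _ (r + i)%N) //; last first.
- by lia.
- by move=> k kW; rewrite /z ap ?addnA.
congr z; rewrite degreeM degreeV.
have -> : (- degree g + degree u = - degree g - M%:Z + i%:Z)%R by lia.
by rewrite -modzDml rE -PoszD modz_nat absz_nat.
Qed.

Lemma periodic_finite_orbit (G : groupType) (psi : G -> G) (A : finType) p
    (z : nat -> A) : (0 < p)%N ->
  strongly_periodic (fun h : hnn psi => z `|(degree h %% p)%Z|%N).
Proof.
move=> p_gt0.
apply: (@sub_finite_set _ _ ((fun k : nat => fun h : hnn psi =>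
  z `|((degree h - k%:Z) %% p)%Z|%N) @` `I_p)); last first.
  exact/finite_image/finite_II.
move=> _ [g _ <-]; have p_neq0 : (p%:Z != 0)%R by lia.
exists `|(degree g %% p)%Z|%N.
  by rewrite /= -ltz_nat gez0_abs ?modz_ge0 ?ltz_pmod.
apply/funext => h; rewrite /shift degreeM degreeV gez0_abs ?modz_ge0 //.
by rewrite [in RHS]GRing.addrC -[in LHS]modzDmr modzNm modzDmr.
Qed.

Theorem theorem1p1 (G : groupType) (psi : {multiplicative G -> G}) (A : finType)
    (G_fg : finitely_generated G) (G_abelian : forall g h : G, commute g h)
    (psi_inj : injective psi) (psi_not_surj : range psi <> [set: G])
    (x : configuration (hnn psi) A) (H : set G) (l : nat)
    (H_subgroup : subgroup H) (psi_H : psi @` H `<=` H)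
    (H_stab : hnn_incl psi @` (iter l psi @` H) `<=` stab x) :
  [/\ forall (h : hnn psi) (n : int), section_level h n ->
        (l%:Z <= n)%R -> section_periodic H x h,
      forall X : set (configuration (hnn psi) A), subshift X -> X x ->
        exists2 y, X y & forall h : hnn psi, section_periodic H y h
    & forall X : set (configuration (hnn psi) A), sft X -> X x -> H = [set: G] ->
        exists y, [/\ X y, forall h : hnn psi, section_periodic H y h
                    & strongly_periodic y]].
Proof.
have stab_iter m g : (l <= m)%N -> H g -> stab x (hnn_incl psi (iter m psi g)).
  move=> lm Hg; apply: H_stab; exists (iter m psi g) => //.
  exists (iter (m - l) psi g); first exact: iter_sub.
  by rewrite -iterD subnKC.
have limit (X : set (configuration (hnn psi) A)) : subshift X -> X x ->
    exists2 y, X y & forall j g, H g ->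
      stab y (hnn_t psi ^- j * hnn_incl psi g * hnn_t psi ^+ j).
  move=> Xs Xx.
  have [y Xy yP] := limit_stab (fun n => hnn_t psi ^- n) Xs Xx.
  exists y => // j g Hg; apply: yP; exists (j + l)%N => n jln.
  by apply: conj_stab_shift; [lia|apply: stab_iter; first lia].
have periodic (y : configuration (hnn psi) A) :
    (forall j g, H g ->
      stab y (hnn_t psi ^- j * hnn_incl psi g * hnn_t psi ^+ j)) ->
    forall h, section_periodic H y h.
  move=> yP h; have [j [a [i ->]]] := hnn_normal_form h.
  by apply: section_periodic_stab => // g Hg; apply: yP; exact: iter_sub.
split.
- move=> _ _ [j [i [a [-> _ ->]]]] lij.
  apply: section_periodic_stab => // g Hg.
  have ji : (j <= i)%N by lia.
  rewrite -{1}(subnKC ji) iterD -mulgA -hnn_tX_incl mulKg.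
  by apply: stab_iter => //; lia.
- by move=> X Xs Xx; have [y Xy /periodic] := limit X Xs Xx; exists y.
- move=> X Xsft Xx HG; have [y Xy yP] := limit X Xsft.1 Xx.
  have [|p [z [p_gt0 Xz]]] := sft_periodic_point Xsft Xy.
    by apply: degree_determined => j g; apply: yP; rewrite HG.
  exists (fun h => z `|(degree h %% p)%Z|%N); split => //.
    move=> h g g' _; rewrite [degree (_ * hnn_incl psi g')]degreeM.
    by rewrite degree_incl GRing.addr0.
  exact: periodic_finite_orbit.
Qed.
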